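(* Let $k>2$ be an integer. The automorphism group of the hyper-star graph $HS(2k,k)$ is a semidirect product $N\rtimes Q$ of a subgroup $N$ by a subgroup $Q$, where $N$ is isomorphic to $\mathrm{Sym}(2k-1)$ and $Q$ is isomorphic to $\mathbb{Z}_2$, the cyclic group of order $2$.
   Context: Hyper-star graph: let $X=\{1,2,\dots,2k\}$. The graph $HS(2k,k)$ is the simple undirected graph whose vertex-set is the set of all $k$-element subsets of $X$, where two vertices $v,w$ are adjacent if and only if $|v\cap w|=k-1$ and the element $1$ belongs to exactly one of $v$ and $w$. (Equivalently, via characteristic functions: vertices are the $\{0,1\}$-sequences of length $2k$ with exactly $k$ ones, two being adjacent if and only if one is obtained from the other by exchanging the first symbol with a different symbol in another position.) A group $G$ is called a semidirect product of $N$ by $Q$, written $G=N\rtimes Q$, if $N$ and $Q$ are subgroups of $G$ such that $N$ is normal in $G$, $NQ=G$, and $N\cap Q=1$. $\mathrm{Sym}(m)$ denotes the group of all permutations of a set with $m$ elements. *)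

(* Defs.v *)
From mathcomp Require Import all_boot all_fingroup.
From mathcomp Require Import zmodp.

Set Implicit Arguments.
Unset Strict Implicit.
Unset Printing Implicit Defensive.

Section GraphAutomorphisms.

Variables (T : finType) (e : rel T).

Definition graph_aut : {set {perm T}} :=
  [set s : {perm T} | [forall x, forall y, e (s x) (s y) == e x y]].

Lemma graph_aut_group_set : group_set graph_aut.
Proof.
apply/group_setP; split=> [|s t].
  by rewrite inE; apply/'forall_forallP=> x y; rewrite !perm1.
rewrite !inE => /'forall_'forall_eqP es /'forall_'forall_eqP et.
by apply/'forall_'forall_eqP=> x y; rewrite !permM et es.
Qed.

Canonical graph_aut_group := Group graph_aut_group_set.

End GraphAutomorphisms.

(* The ground set {1, ..., 2k} is encoded as 'I_(2 * k), the ordinal i standing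
   for the element i + 1. *)
Definition hs_vertex (k : nat) : finType :=
  {v : {set 'I_(2 * k)} | #|v| == k}.

(* The element 1 of the ground set is the ordinal 0; the existential form avoids
   having to exhibit that ordinal when k is a variable. *)
Definition has_one (k : nat) (v : hs_vertex k) : bool :=
  [exists i in val v, nat_of_ord i == 0].

Definition hyper_star (k : nat) : rel (hs_vertex k) :=
  fun v w => (#|val v :&: val w| == k - 1) && (has_one v (+) has_one w).

Lemma hyper_star_sym (k : nat) : symmetric (@hyper_star k).
Proof. by move=> v w; rewrite /hyper_star setIC addbC. Qed.

Lemma hyper_star_irr (k : nat) : irreflexive (@hyper_star k).
Proof. by move=> v; rewrite /hyper_star addbb andbF. Qed.

(* Main.v *)
Require Import Defs.
From mathcomp Require Import all_boot all_fingroup.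
From mathcomp Require Import zmodp.
From mathcomp Require Import cyclic.

Local Open Scope group_scope.

(** Two vertices are adjacent when one arises from the other by exchanging the
    roles of the element 1 (the origin below) and of another element i on which
    the vertex takes the opposite value. So the edges at a vertex v are labelled
    by the k elements i on the opposite side from the origin, and [flip v i] is
    the neighbour along the edge labelled i.

    Permutations of the ground set fixing the origin act on the graph and form a
    copy N of Sym(2k-1). Complementation of sets is an automorphism c of order 2
    which commutes with N and lies outside it, since it moves the origin in or
    out of a vertex. The content of the theorem is that N and c generate
    everything.

    Fix an edge a -- b. An automorphism s sends the edges at a to the edges at
    s a, and those at b to those at s b, so it induces bijections between the
    labels. The labels at a and the labels at b together exhaust the elements
    other than the origin and share only the label of the edge a -- b, on which
    the two bijections agree. They therefore glue to a permutation p fixing the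
    origin. It carries the labels at a to the labels at s a, so it sends a to s a
    or to the complement of s a; composing with c if necessary, one gets an
    element of N<c> that agrees with s on a, on the neighbours of a and on the
    neighbours of b ([aut_decomposition]).

    It remains to see that an automorphism fixing all these vertices is trivial
    ([aut_rigid]). The graph has no 4-cycle ([common_neighbour_unique]) and any
    path of length 3 without backtracking lies on a hexagon ([hexagon]). Fixing
    the two stars at a and b forces the ball of radius 2 about a to be fixed;
    completing paths to hexagons moves this property from a vertex to its
    neighbours, and the graph is connected ([flip_closed_all]). *)

Section HyperStar.

(* The origin and the 2k - 1 other elements are ord0 and the lift ord0 i, read
   through this equality. *)
Variables (k n : nat) (def2k : n.+1 = (2 * k)%N).

(* The ordinal that stands for the element 1 of the ground set. *)
Let z : 'I_(2 * k) := cast_ord def2k ord0.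

Implicit Types (v w u : hs_vertex k) (i j x y : 'I_(2 * k)).
Implicit Types (p q : 'S_(2 * k)) (t : 'S_n) (s : {perm hs_vertex k}).

(** * Vertices and edges *)

Lemma card_vertex v : #|val v| = k.
Proof. exact/eqP/(valP v). Qed.

Lemma card_vertexD1 v x : x \in val v -> #|val v :\ x| = (k - 1)%N.
Proof.
move=> xv; have := cardsD1 x (val v); rewrite xv card_vertex addnC => defk.
by rewrite [in RHS]defk addnK.
Qed.

Lemma half_gt0 : (0 < k)%N.
Proof. by case: k def2k. Qed.

Lemma has_oneE v : has_one v = (z \in val v).
Proof.
apply/existsP/idP=> [[i /andP[iv /eqP i0]]|zv].
  by rewrite (_ : z = i) //; apply: val_inj; rewrite /= i0.
by exists z; rewrite zv.
Qed.

Lemma vertexP v w : val v =i val w -> v = w.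
Proof. by move=> eq_vw; apply/val_inj/setP. Qed.

Lemma card_perm_imset p v : #|p @: val v| == k.
Proof. by rewrite card_imset ?card_vertex //; apply: perm_inj. Qed.

Definition move_vertex p v : hs_vertex k :=
  exist _ (p @: val v) (card_perm_imset p v).

Lemma mem_move p v y : (p y \in val (move_vertex p v)) = (y \in val v).
Proof. by rewrite /= mem_imset //; apply: perm_inj. Qed.

Lemma mem_moveV p v y : (y \in val (move_vertex p v)) = (p^-1 y \in val v).
Proof. by rewrite -{1}(permKV p y) mem_move. Qed.

Lemma move1 v : move_vertex 1 v = v.
Proof. by apply: vertexP => y; rewrite mem_moveV invg1 perm1. Qed.

Lemma moveM p q v : move_vertex (p * q) v = move_vertex q (move_vertex p v).
Proof. by apply: vertexP => y; rewrite !mem_moveV invMg permM. Qed.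

Lemma card_compl_vertex v : #|~: val v| == k.
Proof. by rewrite cardsCs setCK card_vertex card_ord mulSn mul1n addnK. Qed.

Definition compl_vertex v : hs_vertex k := exist _ (~: val v) (card_compl_vertex v).

Lemma mem_compl v y : (y \in val (compl_vertex v)) = (y \notin val v).
Proof. by rewrite /= inE. Qed.

Lemma compl_vertexK : involutive compl_vertex.
Proof. by move=> v; apply: vertexP => y; rewrite !mem_compl negbK. Qed.

(** The labels of the edges at v. This set is v or its complement, whichever
    does not contain the origin. *)
Definition opp_side v : {set 'I_(2 * k)} := [set i | (i \in val v) (+) (z \in val v)].

Lemma in_opp v i : (i \in opp_side v) = (i \in val v) (+) (z \in val v).
Proof. by rewrite inE. Qed.

Lemma z_notin_opp v : z \in opp_side v = false.
Proof. by rewrite in_opp addbb. Qed.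

Lemma opp_neq v i : i \in opp_side v -> (i == z) = false.
Proof. by apply: contraTF => /eqP->; rewrite z_notin_opp. Qed.

Definition flip v i : hs_vertex k := move_vertex (tperm z i) v.

Lemma mem_flip v i y : i \in opp_side v ->
  (y \in val (flip v i)) = (y \in val v) (+) (y == z) (+) (y == i).
Proof.
move=> io; have iz := opp_neq _ _ io; rewrite mem_moveV tpermV.
move: io; rewrite in_opp; case: tpermP => [->|->|].
- by rewrite eqxx eq_sym iz; do 2!case: (_ \in _).
- by rewrite eqxx iz; do 2!case: (_ \in _).
by move=> /eqP/negPf-> /eqP/negPf->; rewrite !addbF.
Qed.

Lemma in_opp_flip v i y : i \in opp_side v ->
  (y \in opp_side (flip v i)) = (y != z) && (~~ (y \in opp_side v) (+) (y == i)).
Proof.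
move=> io; rewrite in_opp !(mem_flip _ _ _ io) [in RHS]in_opp eqxx.
rewrite [z == i]eq_sym (opp_neq _ _ io); case: eqP => [->|_] /=.
  by rewrite [z == i]eq_sym (opp_neq _ _ io); case: (_ \in _).
by case: (y \in _); case: (z \in _); case: (y == i).
Qed.

Lemma flip_opp v i : i \in opp_side v -> i \in opp_side (flip v i).
Proof. by move=> io; rewrite in_opp_flip // io eqxx (opp_neq _ _ io). Qed.

Lemma flipK v i : flip (flip v i) i = v.
Proof. by rewrite /flip -moveM tperm2 move1. Qed.

Lemma flip_inj v i j : i \in opp_side v -> j \in opp_side v ->
  flip v i = flip v j -> i = j.
Proof.
move=> io jo eq_ij; have := mem_flip v i i io; rewrite eq_ij (mem_flip _ _ _ jo).
by case: (i =P j) => // _; case: (i \in val v); rewrite (opp_neq _ _ io) eqxx.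
Qed.

(** If v contains the origin and w does not, the k - 1 common elements are all of
    v but the origin, and w has exactly one further element: the label. *)
Lemma adjP v w :
  reflect (exists2 i, i \in opp_side v & w = flip v i) (hyper_star v w).
Proof.
rewrite /hyper_star !has_oneE; apply: (iffP andP) => [|[i io ->]].
  have main v1 v2 : #|val v1 :&: val v2| = (k - 1)%N -> z \in val v1 ->
      z \notin val v2 -> exists2 i, i \in opp_side v1 & v2 = flip v1 i.
    move=> cI zv1 zv2.
    have defI : val v1 :&: val v2 = val v1 :\ z.
      apply/eqP; rewrite eqEcard cI (card_vertexD1 _ _ zv1) leqnn andbT.
      apply/subsetP => y; rewrite !inE => /andP[-> yv2].
      by rewrite andbT; apply: contraNneq zv2 => <-.
    have /cards1P[i def_i] : #|val v2 :\: val v1| == 1%N.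
      rewrite -(eqn_add2l #|val v2 :&: val v1|) cardsID setIC cI card_vertex.
      by rewrite subnK ?half_gt0.
    have : i \in val v2 :\: val v1 by rewrite def_i set11.
    rewrite inE => /andP[iv1 iv2]; have io : i \in opp_side v1.
      by rewrite in_opp zv1 (negPf iv1).
    exists i => //; apply: vertexP => y; rewrite (mem_flip _ _ _ io).
    have /setP/(_ y) := defI; have /setP/(_ y) := def_i; rewrite !inE.
    case: (y =P z) => [->|_]; first by rewrite (negPf zv2) zv1 andbF /= => <-.
    by case: (y \in val v1) => /= [<-|<-] => [->|].
  case=> /eqP cI; case zv: (z \in val v); case zw: (z \in val w) => //= _.
    by apply: main => //; rewrite zw.
  have [|//||i io ->] := main w v; rewrite 1?setIC ?zv //.
  by exists i; [apply: flip_opp | rewrite flipK].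
split; last first.
  by rewrite (mem_flip _ _ _ io) eqxx eq_sym (opp_neq _ _ io); case: (_ \in _).
have [x xv defI] : exists2 x, x \in val v & val v :&: val (flip v i) = val v :\ x.
  have iz := opp_neq _ _ io.
  move: (io); rewrite in_opp; case zv: (z \in val v) => iv.
    exists z => //; apply/setP => y; rewrite inE (mem_flip _ _ _ io) !inE.
    case: (y =P z) => [->|_]; first by rewrite zv eq_sym iz.
    by case: eqP => [->|_]; [rewrite addbT in iv; rewrite (negPf iv)|case: (_ \in _)].
  rewrite addbF in iv; exists i => //; apply/setP => y.
  rewrite inE (mem_flip _ _ _ io) !inE.
  case: (y =P i) => [->|_]; first by rewrite iv iz.
  by case: eqP => [->|_]; [rewrite zv|case: (_ \in _)].
by rewrite defI (card_vertexD1 _ _ xv).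
Qed.

Lemma adj_flip v i : i \in opp_side v -> hyper_star v (flip v i).
Proof. by move=> io; apply/adjP; exists i. Qed.

(** * Short cycles and connectedness *)

(** The graph has no 4-cycle: u and r differ at the labels i and j of the edges
    to t, so a second common neighbour would have to be reached from u by the
    label j, which is not available there. *)
Lemma common_neighbour_unique u r (t t' : hs_vertex k) : u != r ->
  hyper_star t u -> hyper_star t r ->
  hyper_star u t' -> hyper_star r t' -> t' = t.
Proof.
move=> ur /adjP[i it def_u] /adjP[j jt def_r] /adjP[i' iu def_t'].
move=> /adjP[j' jr def_t'2].
have ij : (i == j) = false by apply: contraNF ur => /eqP e; rewrite def_u def_r e.
have [ii'|/eqP/negPf ii'] := i =P i'; first by rewrite def_t' def_u -ii' flipK.
(* Both paths from t to t' pass through the same set of changes. *)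
have D y : (y == i) (+) (y == i') = (y == j) (+) (y == j').
  have: (y \in val t') = (y \in val t') by [].
  rewrite {1}def_t' def_t'2 (mem_flip _ _ _ iu) (mem_flip _ _ _ jr).
  rewrite def_u def_r (mem_flip _ _ _ it) (mem_flip _ _ _ jt).
  by case: (y \in _); case: (y == z); do 4!case: (y == _).
have ij' : i = j' by apply/eqP; move: (D i); rewrite eqxx ii' ij; case: (i == j').
have ji' : j = i'.
  by apply/eqP; move: (D j); rewrite eqxx -ij' [j == i]eq_sym ij; case: (j == i').
move: iu; rewrite def_u -ji' (in_opp_flip _ _ _ it) jt [j == i]eq_sym ij.
by rewrite andbF.
Qed.

(** Flipping i, j, l, i, j, l in turn closes up, because each of the three
    elements and the origin is changed an even number of times. It is stated as
    two paths of length 3 with the same ends. *)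
Lemma hexagon v i j l : i \in opp_side v -> j \in opp_side (flip v i) ->
  l \in opp_side (flip (flip v i) j) -> i != j -> l != j ->
  [/\ l != i, l \in opp_side v, j \in opp_side (flip v l),
      i \in opp_side (flip (flip v l) j) &
      flip (flip (flip v i) j) l = flip (flip (flip v l) j) i].
Proof.
move=> iv jw lu ij lj.
have iz := opp_neq _ _ iv; have jz := opp_neq _ _ jw; have lz := opp_neq _ _ lu.
have [jv li lv] : [/\ j \notin opp_side v, l != i & l \in opp_side v].
  move: (jw) (lu); rewrite (in_opp_flip _ _ _ jw) !(in_opp_flip _ _ _ iv).
  rewrite (negPf lj) jz lz [j == i]eq_sym (negPf ij) /=.
  case: (l =P i) => [->|_]; first by rewrite iv.
  by do 2!case: (_ \in _).
have jl : j \in opp_side (flip v l).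
  by rewrite (in_opp_flip _ _ _ lv) jz jv eq_sym (negPf lj).
have ir : i \in opp_side (flip (flip v l) j).
  rewrite (in_opp_flip _ _ _ jl) (in_opp_flip _ _ _ lv) iv iz (negPf ij).
  by rewrite [i == l]eq_sym (negPf li).
split=> //; apply: vertexP => y.
rewrite !mem_flip //.
by case: (y \in _); case: (y == z); do 3!case: (y == _).
Qed.

(** Connectedness of the graph. A property that passes to neighbours is preserved
    by every transposition of the origin with another element, as this either
    fixes a vertex or sends it to a neighbour. These transpositions generate all
    permutations, which act transitively on the sets of size k. *)
Lemma flip_closed_all (P : pred (hs_vertex k)) :
  (forall v i, i \in opp_side v -> P v -> P (flip v i)) ->
  forall v w, P v -> P w.
Proof.
move=> clP.
pose G := [set p | [forall v, P v ==> P (move_vertex p v)]].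
have gG : group_set G.
  apply/group_setP; split=> [|p q].
    by rewrite inE; apply/forallP => v; rewrite move1 implybb.
  rewrite !inE => /'forall_implyP Gp /'forall_implyP Gq.
  by apply/'forall_implyP => v Pv; rewrite moveM; apply/Gq/Gp.
have allG p : p \in G.
  have: [set: 'S_(2 * k)] \subset G.
    rewrite -(gen_tperm z) -[G]/(gval (Group gG)) gen_subG.
    apply/subsetP => _ /imsetP[i _ ->]; rewrite inE; apply/'forall_implyP => v Pv.
    have [io|] := boolP (i \in opp_side v); first exact: clP.
    rewrite in_opp => iz; rewrite (_ : move_vertex _ v = v) //.
    apply: vertexP => y; rewrite mem_moveV tpermV; move: iz.
    by case: tpermP => [->|->|]; do 2!case: (_ \in _).
  by move/subsetP; apply; rewrite inE.
(* Transitivity: exchange an element of v outside w with one of w outside v. *)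
move=> v w; have [m] := ubnP #|val v :\: val w|.
elim: m v => // m IHm v lem Pv.
have cD : #|val w :\: val v| = #|val v :\: val w|.
  apply/eqP; rewrite -(eqn_add2l #|val w :&: val v|) cardsID setIC cardsID.
  by rewrite !card_vertex.
have [/eqP|[x xvw]] := set_0Vmem (val v :\: val w).
  move=> D0; suff -> : w = v by [].
  apply/val_inj/eqP; rewrite eqEsubset -!setD_eq0 D0 andbT.
  by rewrite -cards_eq0 cD cards_eq0.
have [y] : exists y, y \in val w :\: val v.
  by apply/set0Pn; rewrite -card_gt0 cD card_gt0; apply/set0Pn; exists x.
rewrite inE => /andP[yv yw]; move: (xvw); rewrite inE => /andP[xw xv].
apply: (IHm (move_vertex (tperm x y) v)); last first.
  by have := allG (tperm x y); rewrite inE => /'forall_implyP; apply.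
rewrite ltnS in lem; apply: leq_trans lem; apply: proper_card.
apply/properP; split.
  apply/subsetP => t; rewrite !inE mem_moveV tpermV => /andP[tw].
  by rewrite tw; case: tpermP => [-> //|ty _|//]; rewrite ty yw in tw.
by exists x => //; rewrite inE mem_moveV tpermV tpermL (negPf yv) andbF.
Qed.

(** * Rigidity *)

Lemma graph_autP s : reflect (forall v w, hyper_star (s v) (s w) = hyper_star v w)
  (s \in graph_aut (@hyper_star k)).
Proof. by rewrite inE; apply: (iffP 'forall_'forall_eqP). Qed.

Lemma aut_flip s v i : s \in graph_aut (@hyper_star k) -> i \in opp_side v ->
  exists2 j, j \in opp_side (s v) & s (flip v i) = flip (s v) j.
Proof. by move=> /graph_autP As io; apply/adjP; rewrite As adj_flip. Qed.

Lemma opp_side_neq0 v : exists i, i \in opp_side v.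
Proof.
have /pred0Pn[x xv] : #|val v| != 0 by rewrite card_vertex -lt0n half_gt0.
case zv: (z \in val v); last by exists x; rewrite in_opp zv addbF.
have /pred0Pn[y yv] : #|val (compl_vertex v)| != 0.
  by rewrite card_vertex -lt0n half_gt0.
by exists y; rewrite in_opp zv addbT -mem_compl.
Qed.

(** The closed ball of radius 2 about v is fixed pointwise by s; it contains v
    itself because every vertex has a neighbour. *)
Definition ball_fixed s v := [forall w, forall u,
  hyper_star v w && hyper_star w u ==> (s w == w) && (s u == u)].

Lemma ball_fixedP s v :
  reflect (forall i j, i \in opp_side v -> j \in opp_side (flip v i) ->
             s (flip v i) = flip v i /\ s (flip (flip v i) j) = flip (flip v i) j)
          (ball_fixed s v).
Proof.
apply: (iffP 'forall_'forall_implyP) => [gv i j iv jw|gv w u].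
  by have /andP[/eqP-> /eqP->] :=
    gv _ _ (introT andP (conj (adj_flip _ _ iv) (adj_flip _ _ jw))).
case/andP=> /adjP[i iv ->] /adjP[j jw ->].
by have [-> ->] := gv i j iv jw; rewrite !eqxx.
Qed.

(** A vertex t at distance 3 from v, reached through w and u, lies on a hexagon
    through v, w and u. The two neighbours of t on that hexagon lie in the ball
    about v, hence are fixed, and t is their only common neighbour. *)
Lemma ball_fixed_step s v i : s \in graph_aut (@hyper_star k) ->
  i \in opp_side v -> ball_fixed s v -> ball_fixed s (flip v i).
Proof.
move=> As iv /ball_fixedP gv; apply/ball_fixedP => j l jw lu.
have [sw su] := gv i j iv jw; split=> //.
have [lj|lj] := eqVneq l j; first by rewrite lj flipK.
have [ij|ij] := eqVneq i j.
  move: lu; rewrite -ij flipK => lv.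
  by have [] := gv l _ lv (flip_opp _ _ lv).
have [li lv jl ir eq_t] := hexagon v i j l iv jw lu ij lj.
have [_ sr] := gv l j lv jl.
set u := flip (flip v i) j in lu su eq_t *; set r := flip (flip v l) j in ir sr eq_t.
have lt := flip_opp _ _ lu.
have it : i \in opp_side (flip u l) by rewrite eq_t flip_opp.
have def_u : u = flip (flip u l) l by rewrite flipK.
have def_r : r = flip (flip u l) i by rewrite eq_t flipK.
move/graph_autP: As => As.
apply: (common_neighbour_unique u r).
- apply: contra li => /eqP ur; apply/eqP.
  by apply: (flip_inj (flip u l)); rewrite // -def_u -def_r.
- by rewrite {2}def_u adj_flip.
- by rewrite {1}def_r adj_flip.
- by rewrite -{1}su As adj_flip.
- by rewrite -{1}sr As eq_t adj_flip.
Qed.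

(** A vertex at distance 2 from a is flip (flip a i) j with j outside opp_side a.
    Its image is flip (flip a i) j' for some j', since s fixes flip a i. When
    i != i0, this vertex has a common neighbour with flip (flip a i0) j, which is
    fixed, so its image has one too. Vertices with a common neighbour differ in at
    most two elements besides the origin, but if j' were different from j, these
    would differ in the four elements i, i0, j and j'. *)
Lemma ball_fixed_of_edge s a i0 : s \in graph_aut (@hyper_star k) ->
  s a = a -> i0 \in opp_side a ->
  (forall i, i \in opp_side a -> s (flip a i) = flip a i) ->
  (forall j, j \in opp_side (flip a i0) ->
     s (flip (flip a i0) j) = flip (flip a i0) j) ->
  ball_fixed s a.
Proof.
move=> As sa i0a fix_a fix_b; apply/ball_fixedP => i j ia jw.
have sw := fix_a i ia; split=> //.
have [j' jw' su] := aut_flip _ _ _ As jw; rewrite sw in jw' su.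
have [ii0|ii0] := eqVneq i i0.
  by subst i; apply: fix_b.
have [ij|ij] := eqVneq i j; first by rewrite -ij flipK.
have [ij'|ij'] := eqVneq i j'.
  have := su; rewrite -ij' flipK -{2}sa => /perm_inj eq_u.
  by rewrite su -ij' flipK eq_u.
rewrite su; congr (flip _ _); apply/eqP/negPn/negP=> jj'.
have iz := opp_neq _ _ ia; have jz := opp_neq _ _ jw.
have i0z := opp_neq _ _ i0a; have jz' := opp_neq _ _ jw'.
have ja : j \notin opp_side a.
  move: (jw); rewrite (in_opp_flip _ _ _ ia) [j == i]eq_sym (negPf ij) jz.
  by case: (_ \in _).
have ja' : j' \notin opp_side a.
  move: (jw'); rewrite (in_opp_flip _ _ _ ia) [j' == i]eq_sym (negPf ij') jz'.
  by case: (_ \in _).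
have i0j : i0 != j by apply: contraNneq ja => <-.
have i0j' : i0 != j' by apply: contraNneq ja' => <-.
have jb : j \in opp_side (flip a i0).
  by rewrite (in_opp_flip _ _ _ i0a) jz ja eq_sym (negPf i0j).
have i0u : i0 \in opp_side (flip (flip a i) j).
  rewrite (in_opp_flip _ _ _ jw) (in_opp_flip _ _ _ ia) i0z i0a (negPf i0j).
  by rewrite eq_sym (negPf ii0).
have [_ _ _ ir eq_t] := hexagon a i j i0 ia jw i0u ij i0j.
have sr := fix_b j jb.
have [m mu st] := aut_flip _ _ _ As i0u.
have [m' mr st'] := aut_flip _ _ _ As ir.
rewrite sr in mr st'; rewrite su in mu st; rewrite -eq_t st in st'.
(* The image of the common neighbour is reached from a by flipping i, j', m and
   also by flipping i0, j, m'. Then i, i0 and j would all be among m and m'. *)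
have D y : (y == i) (+) (y == j') (+) (y == m) = (y == i0) (+) (y == j) (+) (y == m').
  have := congr1 (fun v => y \in val v) st'; rewrite !mem_flip //.
  by case: (y \in _); case: (y == z); do 6!case: (y == _).
move: (D i) (D i0) (D j); rewrite !eqxx (negPf ii0) (negPf ij) (negPf ij').
rewrite [i0 == i]eq_sym (negPf ii0) (negPf i0j) (negPf i0j').
rewrite [j == i]eq_sym (negPf ij) [j == j']eq_sym (negPf jj').
rewrite [j == i0]eq_sym (negPf i0j).
case: (i =P m) => [<-|_]; case: (i =P m') => [<-|_] //=.
  rewrite [i0 == i]eq_sym (negPf ii0) [j == i]eq_sym (negPf ij).
  by case: (i0 =P m') => [<-|//]; rewrite [j == i0]eq_sym (negPf i0j).
rewrite [i0 == i]eq_sym (negPf ii0) [j == i]eq_sym (negPf ij).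
by case: (i0 =P m) => [<-|//]; rewrite [j == i0]eq_sym (negPf i0j).
Qed.

(** By connectedness the fixed ball spreads from a to the whole graph. *)
Lemma aut_rigid s a i0 : s \in graph_aut (@hyper_star k) ->
  s a = a -> i0 \in opp_side a ->
  (forall i, i \in opp_side a -> s (flip a i) = flip a i) ->
  (forall j, j \in opp_side (flip a i0) ->
     s (flip (flip a i0) j) = flip (flip a i0) j) ->
  s = 1.
Proof.
move=> As sa i0a fix_a fix_b.
have ball_a := ball_fixed_of_edge s a i0 As sa i0a fix_a fix_b.
apply/permP => v; rewrite perm1.
have /ball_fixedP gv : ball_fixed s v.
  exact: (flip_closed_all _ (fun v i => ball_fixed_step s v i As) a).
have [i iv] := opp_side_neq0 v.
by have [_] := gv i i iv (flip_opp _ _ iv); rewrite flipK.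
Qed.

(** * The two families of automorphisms *)

Lemma move_inj p : injective (move_vertex p).
Proof.
by apply: (can_inj (g := move_vertex p^-1)) => v; rewrite -moveM mulgV move1.
Qed.

Definition move_perm p : {perm hs_vertex k} := perm (@move_inj p).

Lemma move_permE p v : move_perm p v = move_vertex p v.
Proof. by rewrite permE. Qed.

Lemma move_permM : {morph move_perm : p q / p * q}.
Proof. by move=> p q; apply/permP => v; rewrite permM !move_permE moveM. Qed.

Definition compl_perm : {perm hs_vertex k} := perm (can_inj compl_vertexK).

Lemma compl_permE v : compl_perm v = compl_vertex v.
Proof. by rewrite permE. Qed.

Lemma compl_move p v : compl_vertex (move_vertex p v) = move_vertex p (compl_vertex v).
Proof. by apply: vertexP => y; rewrite mem_compl !mem_moveV mem_compl. Qed.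

Lemma compl_perm_comm p : commute compl_perm (move_perm p).
Proof.
by apply/permP => v; rewrite !permM !move_permE !compl_permE compl_move.
Qed.

Lemma opp_compl v i : (i \in opp_side (compl_vertex v)) = (i \in opp_side v).
Proof. by rewrite !in_opp !mem_compl addNb addbN negbK. Qed.

Lemma eq_opp_side v w : opp_side v =i opp_side w -> v = w \/ v = compl_vertex w.
Proof.
move=> eq_vw; have [zz|zz] := eqVneq (z \in val v) (z \in val w).
  left; apply: vertexP => y; have := eq_vw y; rewrite !in_opp zz.
  by do 3!case: (_ \in _).
right; apply: vertexP => y; have := eq_vw y; rewrite !in_opp mem_compl.
by move: zz; do 4!case: (_ \in _).
Qed.

Lemma opp_move p v i : p z = z ->
  (p i \in opp_side (move_vertex p v)) = (i \in opp_side v).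
Proof.
by move=> pz; rewrite !in_opp mem_move; have := mem_move p v z; rewrite pz => ->.
Qed.

Lemma flip_move p v i : p z = z ->
  move_vertex p (flip v i) = flip (move_vertex p v) (p i).
Proof.
by move=> pz; rewrite /flip -!moveM -{2}pz -tpermJ conjgC.
Qed.

Lemma flip_compl v i : compl_vertex (flip v i) = flip (compl_vertex v) i.
Proof. exact: compl_move. Qed.

Lemma move_aut p : p z = z -> move_perm p \in graph_aut (@hyper_star k).
Proof.
move=> pz; apply/graph_autP => v w; rewrite !move_permE.
apply/adjP/adjP => [[i io eqi]|[i io ->]]; last first.
  by exists (p i); [rewrite opp_move | rewrite flip_move].
rewrite -[i](permKV p) opp_move // -flip_move ?permKV // in io eqi.
by exists (p^-1 i) => //; apply: move_inj eqi.
Qed.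

Lemma compl_aut : compl_perm \in graph_aut (@hyper_star k).
Proof.
apply/graph_autP => v w; rewrite !compl_permE.
apply/adjP/adjP => [] [i io eqi]; exists i.
- by rewrite opp_compl in io.
- by apply: (can_inj compl_vertexK); rewrite flip_compl.
- by rewrite opp_compl.
by rewrite eqi flip_compl.
Qed.

(** Vertices separate elements, so a permutation of the ground set is determined
    by its action on them. *)
Lemma separating_vertex x y : x != y ->
  exists2 v : hs_vertex k, x \in val v & y \notin val v.
Proof.
move=> xy; have : (0 < #|[set A : {set 'I_(2 * k)} |
    A \subset ~: [set x; y] & #|A| == (k - 1)%N]|)%N.
  rewrite cards_draws bin_gt0 cardsCs setCK card_ord cards2 xy.
  by case: k half_gt0 => // k' _; rewrite mulnS !subSS !subn0 mul2n -addnn leq_addr.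
rewrite card_gt0 => /set0Pn[A]; rewrite inE => /andP[sA /eqP cA].
have notA i : i \in [set x; y] -> i \notin A.
  by move=> ixy; apply: contraL ixy => /(subsetP sA); rewrite inE.
have cxA : #|x |: A| == k.
  by rewrite cardsU1 notA ?set21 // cA add1n subn1 prednK // half_gt0.
exists (exist _ (x |: A) cxA : hs_vertex k); rewrite /= !inE ?eqxx //.
by rewrite eq_sym (negPf xy) notA ?set22.
Qed.

Lemma vertex_with_origin : exists v : hs_vertex k, z \in val v.
Proof.
have n_gt0 : (0 < n)%N.
  by case: n def2k half_gt0 => [|//]; case: k => // k'; rewrite mulnS.
have [|v zv _] := separating_vertex z (cast_ord def2k ord_max); last by exists v.
by rewrite -val_eqE /= eq_sym -lt0n.
Qed.

(** * Every automorphism is a permutation, up to complement *)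

(** The function f below reads off how s acts on edge labels, vertex by vertex,
    and g glues its values at the two ends a and b of an edge. *)
Lemma aut_decomposition s : s \in graph_aut (@hyper_star k) ->
  exists (e : bool) p, p z = z /\ s = compl_perm ^+ e * move_perm p.
Proof.
move=> As.
have [f fP] : exists f, forall v i, i \in opp_side v ->
    f v i \in opp_side (s v) /\ s (flip v i) = flip (s v) (f v i).
  exists (fun v i => odflt z
    [pick j | (j \in opp_side (s v)) && (s (flip v i) == flip (s v) j)]) => v i iv.
  case: pickP => [j /andP[jo /eqP]//|none].
  have [j jo sj] := aut_flip _ _ _ As iv.
  by have := none j; rewrite jo sj eqxx.
have f_inj v i j : i \in opp_side v -> j \in opp_side v -> f v i = f v j -> i = j.
  move=> iv jv eqf; apply: (flip_inj _ _ _ iv jv); apply: (@perm_inj _ s).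
  by rewrite (proj2 (fP _ _ iv)) eqf -(proj2 (fP _ _ jv)).
have [a _] := vertex_with_origin.
have [i0 i0a] := opp_side_neq0 a.
have [b def_b] : exists b, b = flip a i0 by exists (flip a i0).
have i0b : i0 \in opp_side b by rewrite def_b flip_opp.
have [fa_i0 sb] := fP _ _ i0a; rewrite -def_b in sb.
have fb_i0 : f b i0 = f a i0.
  have [fb_o eqb] := fP _ _ i0b.
  apply: (flip_inj (s b)); rewrite // -?eqb; first by rewrite sb flip_opp.
  by rewrite sb def_b !flipK.
have opp_b x :
    (x \in opp_side b) = (x != z) && (~~ (x \in opp_side a) (+) (x == i0)).
  by rewrite def_b in_opp_flip.
pose g x := if x == z then z else if x \in opp_side a then f a x else f b x.
(* The labels at b other than i0 are the non-origin elements that are not labels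
   at a, and f b keeps them away from the labels at s a. *)
have far x : x != z -> x \notin opp_side a ->
    [/\ x \in opp_side b, f b x != z & f b x \notin opp_side (s a)].
  move=> xz xa; have xb : x \in opp_side b.
    by rewrite opp_b xz xa (_ : (x == i0) = false) //; apply: contraNF xa => /eqP->.
  have [fb_o _] := fP _ _ xb; split=> //; first by rewrite (opp_neq _ _ fb_o).
  apply: contra xa => fbx; suff -> : x = i0 by [].
  apply: (f_inj b) => //; rewrite fb_i0; apply/eqP.
  by move: fb_o; rewrite sb (in_opp_flip _ _ _ fa_i0) fbx => /andP[_]; case: eqP.
have gz x : (g x == z) = (x == z).
  rewrite /g; case: (x =P z) => [_|/eqP xz]; first exact: eqxx.
  case: ifPn => [xa|xa]; first by rewrite (opp_neq _ _ (proj1 (fP _ _ xa))).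
  by have [_ /negPf] := far x xz xa.
have g_opp x : (g x \in opp_side (s a)) = (x \in opp_side a).
  rewrite /g; case: (x =P z) => [->|/eqP xz]; first by rewrite !z_notin_opp.
  case: ifPn => [xa|xa]; first by have [] := fP _ _ xa.
  by have [_ _ /negPf] := far x xz xa.
have ga x : x \in opp_side a -> g x = f a x.
  by move=> xa; rewrite /g xa (opp_neq _ _ xa).
have gb x : x \in opp_side b -> g x = f b x.
  move=> xb; rewrite /g (opp_neq _ _ xb); case: ifP => // xa.
  by move: xb; rewrite opp_b xa => /andP[_] /eqP->; rewrite fb_i0.
have g_inj : injective g.
  move=> x y eqg; have := g_opp x; have := gz x; rewrite eqg gz g_opp.
  case: (y =P z) => [-> /esym/eqP //|/eqP yz /esym/negbT xz].
  case ya: (y \in _) => /esym xa; first by move: eqg; rewrite !ga //; apply: f_inj.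
  have [yb _ _] := far y yz (negbT ya); have [xb _ _] := far x xz (negbT xa).
  by move: eqg; rewrite !gb //; apply: f_inj.
pose p := perm g_inj; have pE x : p x = g x by rewrite permE.
have pz : p z = z by rewrite pE /g eqxx.
have [e sa] : exists e : bool, s a = (compl_perm ^+ e * move_perm p) a.
  have opp_eq : opp_side (s a) =i opp_side (move_vertex p a).
    by move=> y; rewrite -[y](permKV p) opp_move // pE g_opp.
  case: (eq_opp_side _ _ opp_eq) => ->; [exists false | exists true].
    by rewrite expg0 mul1g move_permE.
  by rewrite expg1 permM move_permE compl_permE compl_move.
exists e, p; split=> //; set s' := _ * _ in sa *.
have s'_flip v i : s' (flip v i) = flip (s' v) (p i).
  rewrite !permM !move_permE -flip_move //; congr (move_vertex _ _).
  by case: (e); rewrite ?expg1 ?compl_permE ?flip_compl // expg0 !perm1.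
have As' : s' \in graph_aut (@hyper_star k).
  by rewrite groupM ?groupX ?move_aut ?compl_aut.
have fix_a i : i \in opp_side a -> s (flip a i) = s' (flip a i).
  by move=> ia; rewrite s'_flip -sa pE ga // (proj2 (fP _ _ ia)).
have agree v : s v = s' v -> (s * s'^-1) v = v by rewrite permM => ->; rewrite permK.
apply/eqP; rewrite -(mulgK s'^-1 s) invgK.
rewrite (aut_rigid (s * s'^-1) a i0) ?mul1g //.
- by rewrite groupM ?groupV.
- exact: agree.
- by move=> i ia; apply/agree/fix_a.
rewrite -def_b => j jb; apply: agree; rewrite s'_flip def_b -fix_a // -def_b pE gb //.
exact: (proj2 (fP _ _ jb)).
Qed.

(** * The structure of the automorphism group *)

Definition extend_perm (t : 'S_n) : 'S_(2 * k) :=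
  cast_perm def2k (lift_perm ord0 ord0 t).

Lemma extend_permM : {morph extend_perm : t t' / t * t'}.
Proof.
by move=> t t'; rewrite /extend_perm -cast_perm_morphM (lift_permM ord0 ord0 ord0).
Qed.

Lemma extend_perm_fix t : extend_perm t z = z.
Proof. by rewrite /extend_perm -cast_ord_permE lift_perm_id. Qed.

Lemma extend_perm_lift t (i : 'I_n) :
  extend_perm t (cast_ord def2k (lift ord0 i)) = cast_ord def2k (lift ord0 (t i)).
Proof. by rewrite /extend_perm -cast_ord_permE lift_perm_lift. Qed.

Lemma extend_perm_onto p : p z = z -> exists t, p = extend_perm t.
Proof.
move=> pz; pose h (i : 'I_n) := cast_ord def2k (lift ord0 i).
have h_inj : injective h by move=> i j /cast_ord_inj/lift_inj.
have hP x : x != z -> exists i : 'I_n, x = h i.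
  move=> xz; have : ord0 != cast_ord (esym def2k) x.
    apply: contraNneq xz => x0; apply/eqP.
    by rewrite -(cast_ordKV def2k x) -x0.
  by case/unlift_some => i def_x _; exists i; rewrite /h -def_x cast_ordKV.
pose t (i : 'I_n) := odflt i [pick j | p (h i) == h j].
have tP (i : 'I_n) : p (h i) = h (t i).
  rewrite /t; case: pickP => [j /eqP//|none].
  have [|j def_j] := hP (p (h i)).
    by rewrite -[X in _ != X]pz (inj_eq perm_inj) -val_eqE.
  by have := none j; rewrite def_j eqxx.
have t_inj : injective t.
  by move=> i j eq_t; apply/h_inj/(@perm_inj _ p); rewrite !tP eq_t.
exists (perm t_inj); apply/permP => x.
have [->|/hP[i ->]] := eqVneq x z; first by rewrite pz extend_perm_fix.
by rewrite extend_perm_lift permE tP.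
Qed.

Definition sym_action (t : 'S_n) : {perm hs_vertex k} := move_perm (extend_perm t).

Lemma sym_actionM : {in [set: 'S_n] &, {morph sym_action : t t' / t * t'}}.
Proof. by move=> t t' _ _; rewrite /sym_action extend_permM move_permM. Qed.

Canonical sym_action_morphism := Morphism sym_actionM.

Lemma move_perm_inj : injective move_perm.
Proof.
move=> p q eq_pq; apply/permP => x; apply/eqP/negPn/negP => /separating_vertex[w pxw].
case/negP; have := mem_move q (move_vertex p^-1 w) x.
rewrite -move_permE -eq_pq move_permE -moveM mulVg move1 => ->.
by rewrite mem_moveV invgK.
Qed.

Lemma extend_perm_inj : injective extend_perm.
Proof.
move=> t t' eq_t; apply/permP => i; apply: (@lift_inj _ ord0).
by apply: (@cast_ord_inj _ _ def2k); rewrite -!extend_perm_lift eq_t.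
Qed.

Lemma sym_action_inj : 'injm sym_action.
Proof. by apply/injmP => t t' _ _ /move_perm_inj/extend_perm_inj. Qed.

Lemma compl_perm_order : #[compl_perm] = 2.
Proof.
apply: nt_prime_order => //.
  by apply/permP => v; rewrite expgS expg1 permM perm1 !compl_permE compl_vertexK.
have [v zv] := vertex_with_origin.
apply/eqP => /permP/(_ v); rewrite compl_permE perm1.
by move/(congr1 (fun w : hs_vertex k => z \in val w)); rewrite mem_compl zv.
Qed.

Lemma graph_aut_sdprod :
  (sym_action @* [set: 'S_n]) ><| <[compl_perm]> = graph_aut (@hyper_star k).
Proof.
have defQ := cycle2g compl_perm_order.
rewrite sdprodE.
- apply/setP => s; apply/mulsgP/idP => [[_ c /morphimP[t _ _ ->] cQ ->]|As].
    rewrite groupM ?move_aut ?extend_perm_fix //.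
    by rewrite /= defQ in cQ; case/set2P: cQ => ->; rewrite ?group1 ?compl_aut.
  have [e [p [pz ->]]] := aut_decomposition s As.
  have [t ->] := extend_perm_onto p pz.
  exists (sym_action t) (compl_perm ^+ e); rewrite ?mem_cycle ?mem_morphim ?inE //.
  exact/esym/commuteX/esym/compl_perm_comm.
- apply: subset_trans (cent_sub _); rewrite cycle_subG; apply/centP.
  by move=> _ /morphimP[t _ _ ->]; apply: compl_perm_comm.
apply/trivgP/subsetP => c /setIP[/morphimP[t _ _ ->]].
rewrite /= defQ !inE => /orP[//|/eqP eq_c].
have [v zv] := vertex_with_origin.
have := mem_move (extend_perm t) v z.
by rewrite extend_perm_fix -move_permE [move_perm _]eq_c compl_permE mem_compl zv.
Qed.

End HyperStar.

Theorem theorem2p4 (k : nat) (hk : (2 < k)%N) :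
  exists N Q : {group {perm (hs_vertex k)}},
    [/\ N ><| Q = graph_aut (@hyper_star k),
        N \isog [set: 'S_(2 * k - 1)] &
        Q \isog [set: 'Z_2]].
Proof.
have def2k : (2 * k - 1).+1 = (2 * k)%N by case: k hk => // k' _; rewrite mulnS subn1.
exists (sym_action k _ def2k @* setT)%G, <[compl_perm k]>%G; split.
- exact: graph_aut_sdprod.
- by rewrite isog_sym; apply/sub_isog/sym_action_inj.
rewrite isog_cyclic_card ?cycle_cyclic // prime_cyclic cardsT card_ord //.
by rewrite -orderE (compl_perm_order k _ def2k).
Qed.
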